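(* Let $G=(V,R,E)$ be a finite knowledge graph with factor graph $G_f$, whose set of triple nodes is $T$, and let $\pi:T\to E$ be the bijection sending each triple node to its triple. Let $Q$ be a basic graph pattern whose set of bound terms $S$ satisfies $S\subseteq V\cup R$, and suppose that every triple pattern of $Q$ contains at least one bound term. Let $\mathcal{N}_2(S)$ be the 2-hop induced subgraph of $S$ in $G_f$, let $T_S = T\cap \mathcal{V}(\mathcal{N}_2(S))$ be the set of triple nodes that are vertices of $\mathcal{N}_2(S)$, and let $G_S := \pi(T_S)$ be the sub-knowledge-graph of $G$ whose set of triples is $\pi(T_S)\subseteq E$. Then \[ \lVert Q\rVert_G = \lVert Q\rVert_{G_S}. \]
   Context: Knowledge graphs. Let $I$, $B$, $L$ be pairwise disjoint sets (IRIs, blank nodes, literals). A knowledge graph is a finite directed edge-labeled multigraph $G=(V,R,E)$ with entity set $V\subseteq I\cup B\cup L$, relation set $R\subseteq I$, and edge set $E\subseteq (I\cup B)\times R\times V$, where the subject of every edge also belongs to $V$. An element $(s,p,o)\in E$ is called a triple with subject $s$, predicate $p$, object $o$. Basic graph patterns. Let $X$ be a set of variables disjoint from $I\cup B\cup L$. A triple pattern is a tuple $tp=(x,y,z)\in (I\cup B\cup X)\times(I\cup X)\times(I\cup B\cup L\cup X)$. A basic graph pattern (BGP) $Q=\{tp_1,\dots,tp_k\}$ is a finite set of triple patterns. $\mathrm{vars}(Q)$ is the set of variables occurring in $Q$. The bound terms of $Q$ are the non-variable terms (elements of $I\cup B\cup L$) occurring in the triple patterns of $Q$; $S$ denotes the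 set of all of them. Cardinality. For a map $\mu:\mathrm{vars}(Q)\to I\cup B\cup L$ and a triple pattern $tp\in Q$, $\mu(tp)$ is the triple obtained from $tp$ by replacing each variable $v$ by $\mu(v)$ (bound terms are left unchanged), and $\mu(Q)=\{\mu(tp) : tp\in Q\}$. For a knowledge graph $H$ with set of triples $E_H$, the cardinality of $Q$ over $H$ is the number of distinct solutions \[ \lVert Q\rVert_H = \bigl|\{\mu:\mathrm{vars}(Q)\to I\cup B\cup L \;:\; \mu(Q)\subseteq E_H\}\bigr|. \] Factor graph. The factor graph $G_f=(V_f,E_f)$ of $G=(V,R,E)$ has node set $V_f=V\cup R\cup T$, where $T$ is a set of new nodes (triple nodes), disjoint from $V\cup R$, containing exactly one node $t_{spo}$ for each triple $(s,p,o)\in E$. For each $(s,p,o)\in E$, the edges of $G_f$ include $(t_{spo},s)$, $(t_{spo},p)$, $(t_{spo},o)$ and their reverses $(s,t_{spo})$, $(p,t_{spo})$, $(o,t_{spo})$, and there are no other edges. Each edge carries a role label recording whether it is a subject, predicate or object edge and its direction (parallel edges with different roles are kept, so $G_f$ is a role-labeled multigraph). The map $\pi:T\to E$, $t_{spo}\mapsto (s,p,o)$, is a bijection. $n$-hop induced subgraph. For $S\subseteq V_f$, let $d_{G_f}$ be the shortest-path distance in $G_f$. The $n$-hop induced subgraph of $S$ is \[ \mathcal{N}_n(S)=G_f\Bigl[\{u\in V_f : \min_{b\in S} d_{G_f}(u,b)\le n\}\Bigr], \] the subgraph of $G_f$ induced on the indicated vertex set (with the minimum over an empty set read as $+\infty$).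 $\mathcal{V}(\cdot)$ denotes the vertex set of a graph. *)

(* Defs.v *)
From mathcomp Require Import all_boot all_order all_algebra.
From mathcomp Require Import finmap.
From mathcomp Require Import boolp classical_sets functions cardinality.
From mathcomp Require Import constructive_ereal.

Set Implicit Arguments.
Unset Strict Implicit.
Unset Printing Implicit Defensive.

Local Open Scope fset_scope.

(* Pairwise disjointness of the IRIs I, blank nodes B, literals L and
   variables X is rendered by disjoint sums of arbitrary types. *)

Notation term I B L := (I + B + L)%type (only parsing).

Definition is_iri (I B L : Type) (x : term I B L) : bool :=
  if x is inl (inl _) then true else false.
Definition is_literal (I B L : Type) (x : term I B L) : bool :=
  if x is inr _ then true else false.

Notation triple I B L :=
  (term I B L * term I B L * term I B L)%type (only parsing).

(* [entities] and [relations] may overlap: an IRI can be both. *)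
Record kg (I B L : choiceType) := KG {
  entities : {fset term I B L};
  relations : {fset term I B L};
  triples : {fset triple I B L};
  relations_iri : forall p, p \in relations -> is_iri p;
  triplesP : forall s p o, (s, p, o) \in triples ->
    [/\ s \in entities, ~~ is_literal s, p \in relations & o \in entities]
}.

Lemma sub_kg_triplesP (I B L : choiceType) (G : kg I B L)
    (F : {set triples G}) (s p o : term I B L) :
  (s, p, o) \in [fset val e | e in F] ->
  [/\ s \in entities G, ~~ is_literal s, p \in relations G & o \in entities G].
Proof.
by case/imfsetP => e _ E; apply: (@triplesP _ _ _ G); rewrite E; apply: valP.
Qed.

(* The ambient entity and relation sets are kept; isolated ones are
   irrelevant to the cardinality of a pattern. *)
Definition sub_kg (I B L : choiceType) (G : kg I B L)
    (F : {set triples G}) : kg I B L :=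
  KG (@relations_iri _ _ _ G) (@sub_kg_triplesP _ _ _ G F).

(* A position of a triple pattern: [inl] of a bound term, or [inr] of a
   variable. *)
Notation atom I B L X := (term I B L + X)%type (only parsing).

Notation tpat I B L X :=
  (atom I B L X * atom I B L X * atom I B L X)%type (only parsing).

Definition wf_tpat (I B L X : Type) (tp : tpat I B L X) : bool :=
  (if tp.1.1 is inl s then ~~ is_literal s else true) &&
  (if tp.1.2 is inl p then is_iri p else true).

Record bgp (I B L X : choiceType) := BGP {
  patterns :> {fset tpat I B L X};
  patternsP : {in patterns, forall tp, wf_tpat tp}
}.

Definition atoms (I B L X : Type) (tp : tpat I B L X) : seq (atom I B L X) :=
  [:: tp.1.1; tp.1.2; tp.2].

Definition atom_term (I B L X : Type) (a : atom I B L X) : option (term I B L) :=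
  if a is inl t then Some t else None.
Definition atom_var (I B L X : Type) (a : atom I B L X) : option X :=
  if a is inr v then Some v else None.

Definition tp_terms (I B L X : Type) (tp : tpat I B L X) : seq (term I B L) :=
  pmap (@atom_term I B L X) (atoms tp).
Definition tp_vars (I B L X : Type) (tp : tpat I B L X) : seq X :=
  pmap (@atom_var I B L X) (atoms tp).

Definition bound_terms (I B L X : choiceType) (Q : bgp I B L X) :
    {fset term I B L} :=
  [fset b in flatten [seq tp_terms tp | tp <- patterns Q]].
Definition vars (I B L X : choiceType) (Q : bgp I B L X) : {fset X} :=
  [fset v in flatten [seq tp_vars tp | tp <- patterns Q]].

(* A variable outside the domain [D] of [mu] is left as it is; this never
   happens when [D = vars Q] and the pattern belongs to [Q]. *)
Definition subst_atom (I B L X : choiceType) (D : {fset X})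
    (mu : {ffun D -> term I B L}) (a : atom I B L X) : atom I B L X :=
  match a with
  | inl t => inl t
  | inr v => if insub v is Some w then inl (mu w) else inr v
  end.

Definition subst_tpat (I B L X : choiceType) (D : {fset X})
    (mu : {ffun D -> term I B L}) (tp : tpat I B L X) : tpat I B L X :=
  (subst_atom mu tp.1.1, subst_atom mu tp.1.2, subst_atom mu tp.2).

Definition tpat_of_triple (I B L X : Type) (e : triple I B L) : tpat I B L X :=
  (inl e.1.1, inl e.1.2, inl e.2).

Definition solutions (I B L X : choiceType) (Q : bgp I B L X) (H : kg I B L) :
    set {ffun vars Q -> term I B L} :=
  [set mu : {ffun vars Q -> term I B L} |
    ([fset subst_tpat mu tp | tp in patterns Q]
       `<=` [fset tpat_of_triple X e | e in triples H])%fset]%classic.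
Arguments solutions {I B L X} Q H _.

(* [fset_set] sends infinite sets to the empty set; by [finite_solutions]
   below this default is never used. *)
Definition cardinality (I B L X : choiceType) (Q : bgp I B L X)
    (H : kg I B L) : nat :=
  #|` fset_set (solutions Q H)|.

Lemma finite_solutions (I B L X : choiceType) (Q : bgp I B L X)
  (H : kg I B L) : finite_set (solutions Q H).
Proof.
pose W : {fset term I B L} :=
  [fset x in flatten [seq [:: e.1.1; e.1.2; e.2] | e <- triples H]].
have WP (e : triple I B L) : e \in triples H ->
    [/\ e.1.1 \in W, e.1.2 \in W & e.2 \in W].
  by move=> eH; split; rewrite inE; apply/flatten_mapP; exists e => //;
    rewrite !inE eqxx ?orbT.
pose f (g : {ffun vars Q -> W}) : {ffun vars Q -> term I B L} :=
  [ffun v => val (g v)].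
apply: (@sub_finite_set _ _ (f @` setT)%classic); last first.
  exact/finite_image/finite_finset.
move=> mu /= /fsubsetP muH.
have muW v : mu v \in W.
  have := valP v; rewrite inE => /flatten_mapP[tp tpQ].
  have /muH/imfsetP[e /= /WP[W1 W2 W3]] :
      subst_tpat mu tp \in [fset subst_tpat mu tp | tp in patterns Q].
    by apply/imfsetP; exists tp.
  rewrite /subst_tpat /tpat_of_triple => -[E1 E2 E3].
  have key a x : subst_atom mu a = inl x -> x \in W ->
      val v \in pmap (@atom_var I B L X) [:: a] -> mu v \in W.
    case: a => [//|w] /= E xW; rewrite inE => /eqP vw.
    by move: E; rewrite -vw valK => -[->].
  rewrite /tp_vars /atoms -cat1s -[[:: tp.1.2; _]]cat1s !pmap_cat !mem_cat.
  by case/or3P; [exact: key E1 W1|exact: key E2 W2|exact: key E3 W3].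
exists [ffun v => [` muW v]] => //.
by apply/ffunP => v; rewrite !ffunE.
Qed.

(* Finite edge-labelled directed multigraphs: [edge l u v] says that there is
   an [l]-labelled edge from [u] to [v], so that parallel edges are
   distinguished by their labels. *)
Record lgraph (N : choiceType) (Lab : Type) := LGraph {
  vertices : {fset N};
  edge : Lab -> rel N;
  edgeP : forall l u v, edge l u v -> (u \in vertices) && (v \in vertices)
}.

Lemma induced_edgeP (N : choiceType) (Lab : Type) (G : lgraph N Lab)
    (W : {fset N}) (l : Lab) (u v : N) :
  [&& u \in W, v \in W & edge G l u v] ->
  (u \in vertices G `&` W) && (v \in vertices G `&` W).
Proof.
case/and3P => uW vW uv; have /andP[uG vG] := edgeP uv.
by rewrite !in_fsetI uG vG uW.
Qed.

Definition induced (N : choiceType) (Lab : Type) (G : lgraph N Lab)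
    (W : {fset N}) : lgraph N Lab :=
  LGraph (@induced_edgeP _ _ G W).

Definition adjacent (N : choiceType) (Lab : Type) (G : lgraph N Lab) : rel N :=
  fun u v => `[< exists l, edge G l u v >].

Definition walk (N : choiceType) (Lab : Type) (G : lgraph N Lab)
    (k : nat) (u v : N) : Prop :=
  exists p : seq N, [/\ path (adjacent G) u p, last u p = v & size p = k].

(* Length of a shortest walk, +oo when there is none. *)
Definition dist (N : choiceType) (Lab : Type) (G : lgraph N Lab)
    (u v : N) : \bar int :=
  if pselect (exists k, `[< walk G k u v >]) is left h
  then (Posz (ex_minn h))%:E%E else +oo%E.

Definition hop_subgraph (N : choiceType) (Lab : Type) (G : lgraph N Lab)
    (n : nat) (S : {fset N}) : lgraph N Lab :=
  induced G [fset u in vertices G |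
    (\big[Order.min/+oo%E]_(b <- S) dist G u b <= (Posz n)%:E)%E].

Inductive role := Subject | Predicate | Object.
Inductive direction := FromTriple | ToTriple.

Definition component (I B L : Type) (r : role) (e : triple I B L) :
    term I B L :=
  match r with
  | Subject => e.1.1
  | Predicate => e.1.2
  | Object => e.2
  end.

(* Nodes of the factor graph: [inl] of an entity or relation, [inr] of a triple
   node.  The finite type [T] of triple nodes is arbitrary; [pi] sends a triple
   node to its triple, and "exactly one node per triple" is bijectivity of
   [pi], to be assumed separately. *)
Notation fnode I B L T := (term I B L + T)%type (only parsing).

Section FactorGraph.
Context (I B L : choiceType) (G : kg I B L) (T : finType).
Context (pi : T -> triples G).

Definition factor_vertices : {fset fnode I B L T} :=
  [fset (inl x : fnode I B L T) | x in entities G `|` relations G] `|`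
  [fset (inr t : fnode I B L T) | t in [set: T]].

Definition factor_edge (l : role * direction) : rel (fnode I B L T) :=
  fun u v =>
    match l.2, u, v with
    | FromTriple, inr t, inl x => component l.1 (val (pi t)) == x
    | ToTriple, inl x, inr t => component l.1 (val (pi t)) == x
    | _, _, _ => false
    end.

Lemma factor_edgeP l u v : factor_edge l u v ->
  (u \in factor_vertices) && (v \in factor_vertices).
Proof.
have tV t : inr t \in factor_vertices.
  by rewrite inE; apply/orP; right; apply/imfsetP; exists t; rewrite ?inE.
have cV r t : inl (component r (val (pi t))) \in factor_vertices.
  rewrite inE; apply/orP; left; apply/imfsetP.
  exists (component r (val (pi t))) => //=.
  case: (pi t) => -[[s p] o] /= /triplesP[sV _ pR oV].
  by rewrite inE; case: r => /=; rewrite ?sV ?pR ?oV ?orbT.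
case: l => r []; case: u => [x|t]; case: v => [y|t'] //=;
  by rewrite /factor_edge /= => /eqP <-; rewrite cV tV.
Qed.

Definition factor_graph : lgraph (fnode I B L T) (role * direction) :=
  LGraph factor_edgeP.
End FactorGraph.

(* Main.v *)
(* A triple of G matched by a pattern of Q contains a bound term of that
   pattern, so its triple node is adjacent to a node of S. *)

Require Import Defs.
From mathcomp Require Import all_boot all_order all_algebra.
From mathcomp Require Import finmap.

From mathcomp Require Import boolp classical_sets constructive_ereal.

Import Order.TTheory.

Local Open Scope fset_scope.

(** The two solution sets are equal, not merely equinumerous. Every triple of [G_S] is one of [G],
    which gives one inclusion. Conversely, a solution over [G] leaves bound terms fixed, so each
    triple it produces has a bound term as a component ([bound_term_component]); its triple node is
    one edge away from [S], hence lies in [T_S] ([mem_hop_subgraph]). *)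

Lemma dist_le_walk (N : choiceType) (Lab : Type) (G : lgraph N Lab)
    (k : nat) (u v : N) :
  walk G k u v -> (dist G u v <= (Posz k)%:E)%E.
Proof.
move=> /asboolP wk; rewrite /dist; case: pselect => [h|[]]; last by exists k.
by rewrite lee_fin; case: ex_minnP => m _ /(_ _ wk).
Qed.

(** A single walk is enough: its length bounds [dist G u b], which in turn bounds the minimum over
    [S]. *)
Lemma mem_hop_subgraph (N : choiceType) (Lab : Type) (G : lgraph N Lab)
    (n k : nat) (S : {fset N}) (u b : N) :
  u \in vertices G -> b \in S -> walk G k u b -> (k <= n)%N ->
  u \in vertices (hop_subgraph G n S).
Proof.
move=> uG bS wk kn; rewrite !inE uG /=.
apply: (bigmin_inf_seq _ b) => //.
apply: le_trans (dist_le_walk _ _ _ _ _ _ wk) _.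
by rewrite lee_fin.
Qed.

(** Substitution moves no bound term, so the position of [b] in [tp] is the role [r]. *)
Lemma bound_term_component (I B L X : choiceType) (D : {fset X})
    (mu : {ffun D -> term I B L}) (tp : tpat I B L X) (e : triple I B L)
    (b : term I B L) :
  subst_tpat mu tp = tpat_of_triple X e ->
  b \in tp_terms tp -> exists r, component r e = b.
Proof.
case: tp => -[x y] z [Ex Ey Ez]; rewrite mem_pmap => /mapP[a].
rewrite !inE => /or3P[] /eqP -> /=.
- by case: x Ex => //= x [->] [->]; exists Subject.
- by case: y Ey => //= y [->] [->]; exists Predicate.
- by case: z Ez => //= z [->] [->]; exists Object.
Qed.

Theorem theorem1 (I B L X : choiceType) (G : kg I B L)
    (T : finType) (pi : T -> triples G) (pi_bij : bijective pi)
    (Q : bgp I B L X)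
    (S_sub : bound_terms Q `<=` entities G `|` relations G)
    (Q_bound : forall tp : tpat I B L X, tp \in patterns Q ->
       exists b : term I B L, b \in tp_terms tp) :
  let S : {fset fnode I B L T} := [fset inl b | b in bound_terms Q] in
  let N2S := hop_subgraph (factor_graph pi) 2 S in
  let T_S : {set T} := [set t | inr t \in vertices N2S] in
  let G_S := sub_kg (pi @: T_S) in
  cardinality Q G = cardinality Q G_S.
Proof.
move=> S N2S T_S G_S; rewrite /cardinality.
suff -> : solutions Q G = solutions Q G_S by [].
apply/seteqP; split=> mu /fsubsetP muE; apply/fsubsetP => q qQ; last first.
  (* From [G_S] to [G]: triples of [G_S] are values of elements of [triples G]. *)
  have /imfsetP[_ /imfsetP[e _ ->] ->] := muE _ qQ.
  by apply/imfsetP; exists (val e) => //; apply: valP.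
have /imfsetP[e /= eG qe] := muE _ qQ; rewrite qe.
have /imfsetP[tp /= tpQ qtp] := qQ; rewrite qtp in qe.
have [b b_tp] := Q_bound _ tpQ.
have [r er] := bound_term_component _ _ _ _ _ _ _ _ _ qe b_tp.
(* The right inverse of [pi] supplies the triple node over [e]. *)
case: pi_bij => pi' _ pi'K.
apply/imfsetP; exists e => //=; apply/imfsetP; exists [` eG] => //=.
apply/imsetP; exists (pi' [` eG]); last by rewrite pi'K.
have tb : edge (factor_graph pi) (r, FromTriple)
    (inr (pi' [` eG])) (inl b) by rewrite /= /factor_edge /= pi'K er.
(* The walk is the single edge [tb], of length 1, within the radius 2. *)
rewrite inE; apply: (@mem_hop_subgraph _ _ _ _ 1%N _ _ (inl b)) => //.
- by have /andP[] := edgeP tb.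
- apply/imfsetP; exists b => //=; rewrite inE; apply/flatten_mapP.
  by exists tp.
- exists [:: inl b]; split=> //=; rewrite andbT.
  by apply/asboolP; exists (r, FromTriple).
Qed.
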